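(* Let $\mathbb{F}$ be an algebraically closed field of characteristic $0$, let $m,n>1$ be integers, let $\lambda,\mu\in\mathbb{F}$, and let $p(x,y)=\sum_{0\le i,j\le K}a_{ij}x^iy^j\in\mathbb{F}[x,y]$ be non-constant, with local degree $d\ge1$ at $(\lambda,\mu)$. Let $P(J_m(\lambda),J_n(\mu))=\sum_{0\le i,j\le K}a_{ij}\,(J_m(\lambda)^i\otimes J_n(\mu)^j)$, and write $P(J_m(\lambda),J_n(\mu))=p(\lambda,\mu)I_{mn}+Z_{m-1}$, where $Z_{m-1}$ is nilpotent. Then the size of every Jordan block in the Jordan canonical form of $P(J_m(\lambda),J_n(\mu))$ is bounded above by $\left\lceil\frac{m+n-1}{d}\right\rceil$.
   Context: $\otimes$ is the Kronecker product. $J_m(\lambda)=\lambda I_m+N_m$ is the $m\times m$ Jordan block with eigenvalue $\lambda$ ($N_m$ has ones on the first superdiagonal and zeros elsewhere). Hasse derivatives: $\hat\partial_{x^\beta y^\gamma}p=\frac{1}{\beta!\,\gamma!}\frac{\partial^{\beta+\gamma}p}{\partial x^\beta\partial y^\gamma}$. The local degree of a non-constant $p\in\mathbb{F}[x,y]$ at $(\lambda,\mu)\in\mathbb{F}^2$ is the smallest integer $d\ge1$ such that there exist nonnegative integers $\beta,\gamma$ with $\beta+\gamma=d$ and $\hat\partial_{x^\beta y^\gamma}p(\lambda,\mu)\neq0$. *)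

(* Defs.v *)
From mathcomp Require Import all_boot all_order all_algebra.
From mathcomp Require Import mpoly.
From mathcomp.real_closed Require Export mxtens.

Set Implicit Arguments.
Unset Strict Implicit.
Unset Printing Implicit Defensive.

Import GRing.Theory Num.Theory.
Local Open Scope ring_scope.

(* F[x,y] is {mpoly F[2]}, with x the variable of index 0 and y that of
   index 1. *)

Definition ix : 'I_2 := ord0.
Definition iy : 'I_2 := ord_max.

Definition eval2 (R : comNzRingType) (p : {mpoly R[2]}) (lambda mu : R) : R :=
  p.@[tnth [tuple lambda; mu]].

Definition hasse (F : fieldType) (b c : nat) (p : {mpoly F[2]}) :
    {mpoly F[2]} :=
  (b`!%:R * c`!%:R)^-1 *: p^`M[U_(ix) *+ b + U_(iy) *+ c].

Definition local_degree (F : fieldType) (p : {mpoly F[2]}) (lambda mu : F)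
    (d : nat) : Prop :=
  let nonvanishing e := exists b c : nat,
    (b + c)%N = e /\ eval2 (hasse b c p) lambda mu != 0 in
  [/\ (1 <= d)%N, nonvanishing d
    & forall e : nat, (1 <= e)%N -> nonvanishing e -> (d <= e)%N].

Definition nilpotent_mx (R : pzRingType) (n : nat) (A : 'M[R]_n) : Prop :=
  exists k : nat, A ^+ k = 0.

Definition jordan_shift (R : pzRingType) (n : nat) : 'M[R]_n :=
  \matrix_(i, j) ((j : nat) == i.+1)%:R.

Definition jordan_block (R : pzRingType) (n : nat) (a : R) : 'M[R]_n :=
  a%:M + jordan_shift R n.

Arguments jordan_block {R} n a.

(* A has a Jordan canonical form with r blocks, the l-th one being
   jordan_block (size l) (ev l); the equality e only makes the block-diagonal
   matrix have the dimension of A. Blocks of size 0 are excluded. *)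
Definition is_jordan_form (F : fieldType) (N : nat) (A : 'M[F]_N)
    (r : nat) (size : 'I_r -> nat) (ev : 'I_r -> F) : Prop :=
  (forall l, (0 < size l)%N) /\
  exists e : (\sum_(l < r) size l)%N = N,
    A ~_{in unitmx}
      castmx (e, e) (\mxdiag_(l < r) jordan_block (size l) (ev l)).

(* Main.v *)
Require Import Defs.
From mathcomp Require Import all_boot all_order all_algebra.
From mathcomp Require Import mpoly ring.

Set Implicit Arguments.
Unset Strict Implicit.
Unset Printing Implicit Defensive.

Import GRing.Theory Num.Theory.
Local Open Scope ring_scope.

(** Give the basis vector [e_i (x) e_j] of the tensor product the weight
    [i + j]; weights run from [0] to [m + n - 2].  The entry of [J_m(a) ^+ i] at
    [(u, v)] is, for [u <= v], the Hasse derivative of order [v - u] of [x ^ i]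
    at [a], and [0] otherwise ([jordan_block_exprE]).  Hence the entry of [P]
    from [(u1, u2)] to [(v1, v2)] is the Hasse derivative of [p] of order
    [(v1 - u1, v2 - u2)] at [(lambda, mu)] when both differences are
    nonnegative, and [0] otherwise ([poly_tens_jordanE]).  By definition of the
    local degree [d], those of total order strictly between [0] and [d] vanish,
    and the one of order [0] is removed in [Z]; hence [Z] raises weights by at
    least [d] ([nilpotent_part_raises_weight]).  Then [Z ^+ k] raises them by at least [k * d], and so vanishes as soon as
    [m + n - 1 <= k * d]; in particular for [k] the ceiling of the statement.

    On the other side, if [P - c] has vanishing [k]-th power, then so has
    [J - c] for every Jordan block [J] of [P], as taking powers commutes with
    similarity and works block by block; and a Jordan block of size [s], with
    any eigenvalue, has a [1] on the [k]-th superdiagonal of its [k]-th power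
    when [k < s].  So [s <= k] ([jordan_form_size_le]). *)

(** * Powers of Jordan blocks *)

Lemma jordan_block_subr (R : pzRingType) (n : nat) (a c : R) :
  jordan_block n a - c%:M = jordan_block n (a - c).
Proof. by rewrite /jordan_block addrAC -raddfB. Qed.

Lemma mulmx_jordan_blockE (R : comPzRingType) (n : nat) (a : R)
    (A : 'M[R]_n) (u v w : 'I_n) :
  w.+1 = v -> (A *m jordan_block n a) u v = A u v * a + A u w.
Proof.
move=> wv; rewrite /jordan_block mulmxDr mxE mul_mx_scalar !mxE mulrC.
congr (_ + _); rewrite (bigD1 w) //= !mxE -wv eqxx mulr1 big1 ?addr0 // => z nzw.
rewrite mxE -wv eqSS [(w : nat) == z]eq_sym.
by move: nzw; rewrite -val_eqE /= => /negPf ->; rewrite mulr0.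
Qed.

Lemma mulmx_jordan_blockE0 (R : comPzRingType) (n : nat) (a : R)
    (A : 'M[R]_n) (u v : 'I_n) :
  v = 0%N :> nat -> (A *m jordan_block n a) u v = A u v * a.
Proof.
move=> v0; rewrite /jordan_block mulmxDr mxE mul_mx_scalar !mxE mulrC.
by rewrite big1 ?addr0 // => z _; rewrite mxE v0 mulr0.
Qed.

(** Pascal's rule, read along the superdiagonals: multiplying by the Jordan
    block scales each column by [a] and adds the previous column. *)
Lemma jordan_block_exprE (R : comPzRingType) (n : nat) (a : R) (i : nat)
    (u v : 'I_n) :
  (jordan_block n a ^+ i) u v =
    if (u <= v)%N then (a ^+ (i - (v - u))) *+ 'C(i, v - u) else 0.
Proof.
elim: i u v => [|i IHi] u v.
  rewrite expr0 mxE -val_eqE /= sub0n expr0 bin0n subn_eq0.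
  by case: (ltngtP u v).
rewrite exprSr.
(* Also true for [b > i], where the exponents are truncated but the binomial
   coefficient is [0]. *)
have stepD (b : nat) : a ^+ (i - b) *+ 'C(i, b) * a = a ^+ (i.+1 - b) *+ 'C(i, b).
  case: (leqP b i) => [le_bi|lt_ib]; last by rewrite bin_small // mulr0n mul0r.
  by rewrite mulrnAl -exprSr subSn.
case: (posnP v) => [v0|v_gt0].
  rewrite mulmx_jordan_blockE0 // IHi v0 leqn0.
  case: eqP => [->|_]; last by rewrite mul0r.
  by rewrite subnn stepD !bin0.
have [w wv] : exists w : 'I_n, w.+1 = v.
  have w_lt : (v.-1 < n)%N by rewrite (leq_ltn_trans (leq_pred _)).
  by exists (Ordinal w_lt); rewrite /= prednK.
rewrite (mulmx_jordan_blockE _ _ _ wv) !IHi -wv.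
move: (nat_of_ord w) (nat_of_ord u) => {v_gt0 wv}w {}u.
case: (ltngtP u w.+1) => [|lt_wu|->].
- rewrite ltnS => le_uw; rewrite le_uw subSn // stepD !subSS binS.
  by rewrite mulrnDr.
- by rewrite leqNgt (leq_trans _ lt_wu) //= mul0r addr0.
- by rewrite ltnn subnn stepD !bin0 addr0.
Qed.

(** On the [k]-th superdiagonal of the [k]-th power the eigenvalue occurs with
    exponent [0], so that the entries there are [1]. *)
Lemma jordan_block_expr_eq0 (R : comNzRingType) (n : nat) (a : R) (k : nat) :
  jordan_block n a ^+ k = 0 -> (n <= k)%N.
Proof.
move=> Jk0; rewrite leqNgt; apply/negP => lt_kn.
have n_gt0 := leq_ltn_trans (leq0n k) lt_kn.
move/matrixP: Jk0 => /(_ (Ordinal n_gt0) (Ordinal lt_kn)).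
rewrite jordan_block_exprE mxE /= subn0 subnn binn expr0 => /eqP.
by rewrite oner_eq0.
Qed.

(** * Sizes of the blocks of a Jordan form *)

Lemma mxdiag_expr (R : pzRingType) (r : nat) (s : 'I_r -> nat)
    (D : forall l, 'M[R]_(s l)) (k : nat) :
  (\mxdiag_l D l) ^+ k = \mxdiag_l (D l ^+ k).
Proof.
elim: k => [|k IHk]; first exact/esym/mxdiagZ.
rewrite exprS IHk -mulmxE {2}/mxdiag mul_mxdiag_mxblock.
apply/eq_mxblockP => i j; case: eqP => [<-|_]; last by rewrite mulmx0.
by rewrite !conform_mx_id exprS mulmxE.
Qed.

Lemma mulmx_intertwine_expr (R : pzRingType) (n : nat) (V A B : 'M[R]_n)
    (k : nat) :
  V *m A = B *m V -> V *m A ^+ k = B ^+ k *m V.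
Proof.
move=> VA; elim: k => [|k IHk]; first by rewrite !expr0 mulmx1 mul1mx.
by rewrite exprSr -mulmxE mulmxA IHk -mulmxA VA mulmxA exprSr.
Qed.

(** Vanishing of the [k]-th power passes to every block of the form.  A block
    shifted by [c] is still a Jordan block, for the eigenvalue [ev l - c], and
    the [k]-th power of a Jordan block of size larger than [k] is nonzero
    whatever its eigenvalue. *)
Lemma jordan_form_size_le (F : fieldType) (N : nat) (A : 'M[F]_N) (c : F)
    (k r : nat) (size : 'I_r -> nat) (ev : 'I_r -> F) :
  is_jordan_form A size ev -> (A - c%:M) ^+ k = 0 ->
  forall l, (size l <= k)%N.
Proof.
case=> _ [e]; case: _ / e A => A; rewrite castmx_id => -[V Vunit].
move=> /(simmxP Vunit) VA Ack0 l.
set D := \mxdiag_l _ in VA.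
have VAc : V *m (A - c%:M) = (D - c%:M) *m V.
  by rewrite mulmxBr mulmxBl VA scalar_mxC.
have Dck0 : (D - c%:M) ^+ k = 0.
  have := mulmx_intertwine_expr k VAc; rewrite Ack0 mulmx0 => /esym DV0.
  by rewrite -[LHS](mulmxK Vunit) DV0 mul0mx.
move: Dck0; rewrite /D -(mxdiagZ c) -mxdiagB mxdiag_expr -mxdiag0.
move/eq_mxdiagP/(_ l); rewrite jordan_block_subr.
exact: jordan_block_expr_eq0.
Qed.

(** * Matrices raising a weight *)

Definition raises_weight (R : pzRingType) (N : nat) (w : 'I_N -> nat) (e : nat)
    (A : 'M[R]_N) : Prop :=
  forall u v, A u v != 0 -> (w u + e <= w v)%N.

Lemma raises_weight_mul (R : pzRingType) (N : nat) (w : 'I_N -> nat)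
    (e f : nat) (A B : 'M[R]_N) :
  raises_weight w e A -> raises_weight w f B ->
  raises_weight w (e + f) (A *m B).
Proof.
move=> wA wB u v; apply: contraR; rewrite -ltnNge => lt_v.
rewrite mxE big1 // => z _.
case: (eqVneq (A u z) 0) => [->|/wA le_z]; first by rewrite mul0r.
case: (eqVneq (B z v) 0) => [->|/wB le_v]; first by rewrite mulr0.
by move: lt_v; rewrite ltnNge addnA (leq_trans _ le_v) ?leq_add2r.
Qed.

Lemma raises_weight_expr (R : pzRingType) (N : nat) (w : 'I_N -> nat)
    (e : nat) (A : 'M[R]_N) (k : nat) :
  raises_weight w e A -> raises_weight w (k * e) (A ^+ k).
Proof.
move=> wA; elim: k => [|k IHk] => [u v|].
  by rewrite expr0 mxE; case: (u =P v) => [->|_]; rewrite ?addn0 ?eqxx.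
by rewrite exprS mulSn; apply: raises_weight_mul.
Qed.

Lemma raises_weight_eq0 (R : pzRingType) (N : nat) (w : 'I_N -> nat)
    (e : nat) (A : 'M[R]_N) :
  raises_weight w e A -> (forall u, (w u < e)%N) -> A = 0.
Proof.
move=> wA w_lt; apply/matrixP => u v; rewrite mxE; apply/eqP.
apply: contraT => /wA; rewrite leqNgt => /negP[].
exact: leq_trans (w_lt v) (leq_addl _ _).
Qed.

(** * Hasse derivatives and the entries of P *)

Lemma hasse00 (F : fieldType) (p : {mpoly F[2]}) : hasse 0 0 p = p.
Proof.
by rewrite /hasse !mulm0n addm0 mderivm0m fact0 mul1r invr1 scale1r.
Qed.

Lemma eval2_sum (R : comNzRingType) (I : Type) (s : seq I)
    (p : I -> {mpoly R[2]}) (x y : R) :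
  eval2 (\sum_(i <- s) p i) x y = \sum_(i <- s) eval2 (p i) x y.
Proof. exact: raddf_sum. Qed.

Lemma hasse_sum (F : fieldType) (I : Type) (s : seq I)
    (p : I -> {mpoly F[2]}) (b c : nat) :
  hasse b c (\sum_(i <- s) p i) = \sum_(i <- s) hasse b c (p i).
Proof. by rewrite /hasse raddf_sum scaler_sumr. Qed.

(** Differentiation produces falling factorials; dividing them by [b`! * c`!],
    nonzero in characteristic [0], leaves binomial coefficients. *)
Lemma eval2_hasse_monomial (F : fieldType) (charF0 : [pchar F] =i pred0)
    (b c i j : nat) (x y k : F) :
  eval2 (hasse b c (k *: ('X_ix ^+ i * 'X_iy ^+ j))) x y =
    k * (x ^+ (i - b) *+ 'C(i, b) * (y ^+ (j - c) *+ 'C(j, c))).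
Proof.
have fact_neq0 (q : nat) : q`!%:R != 0 :> F.
  by rewrite (pcharf0P F).1 // -lt0n fact_gt0.
rewrite /eval2 /hasse mderivmZ !mpolyXn -mpolyXD mderivmX !mevalZ mevalX.
rewrite !big_ord_recl !big_ord0 !mulr1 !muln1 /=.
have -> : lift ord0 ord0 = iy :> 'I_2 by apply: val_inj.
rewrite -[ord0]/ix !(mnmBE, mnmDE, mulmnE, mnm1E) /= ?eqxx.
rewrite !(mul0n, mul1n, muln0, addn0, add0n, muln1) !(tnth_nth 0) /=.
rewrite -!bin_ffact !natrM -[_ *+ 'C(i, b)]mulr_natl -[_ *+ 'C(j, c)]mulr_natl.
by field; rewrite !fact_neq0.
Qed.

Lemma poly_tens_jordanE (F : fieldType) (charF0 : [pchar F] =i pred0)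
    (m n : nat) (lambda mu : F) (K : nat) (a : nat -> nat -> F)
    (u1 v1 : 'I_m) (u2 v2 : 'I_n) :
  (\sum_(i < K.+1) \sum_(j < K.+1)
      a i j *: (jordan_block m lambda ^+ i *t jordan_block n mu ^+ j))
    (mxtens_index (u1, u2)) (mxtens_index (v1, v2)) =
  if (u1 <= v1)%N && (u2 <= v2)%N then
    eval2 (hasse (v1 - u1) (v2 - u2)
      (\sum_(i < K.+1) \sum_(j < K.+1) a i j *: ('X_ix ^+ i * 'X_iy ^+ j)))
      lambda mu
  else 0.
Proof.
transitivity (\sum_(i < K.+1) \sum_(j < K.+1)
    a i j * ((jordan_block m lambda ^+ i) u1 v1
             * (jordan_block n mu ^+ j) u2 v2)).
  rewrite summxE; apply: eq_bigr => i _; rewrite summxE.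
  by apply: eq_bigr => j _; rewrite mxE tensmxE.
case: ifP => [/andP[le1 le2]|].
  rewrite hasse_sum eval2_sum; apply: eq_bigr => i _.
  rewrite hasse_sum eval2_sum; apply: eq_bigr => j _.
  by rewrite eval2_hasse_monomial // !jordan_block_exprE le1 le2.
move=> /negbT; rewrite negb_and => nle.
rewrite big1 // => i _; rewrite big1 // => j _; rewrite !jordan_block_exprE.
by case/orP: nle => /negPf ->; rewrite ?(mul0r, mulr0).
Qed.

Definition tens_weight (m n : nat) (u : 'I_(m * n)) : nat :=
  (mxtens_unindex u).1 + (mxtens_unindex u).2.

Lemma tens_weight_lt (m n : nat) (u : 'I_(m * n)) :
  (tens_weight u < m + n - 1)%N.
Proof.
rewrite /tens_weight; case: (mxtens_unindex u) => i j /=.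
by rewrite ltn_subRL add1n -addSn -addnS leq_add.
Qed.

(** An entry of [Z] that joins distinct basis vectors is [0] or a Hasse
    derivative of [p] whose order is positive and equal to the increase of
    weight, so the minimality of [d] applies to it; on the diagonal the value of
    [p] cancels. *)
Lemma nilpotent_part_raises_weight (F : fieldType)
    (charF0 : [pchar F] =i pred0) (m n : nat) (lambda mu : F) (K : nat)
    (a : nat -> nat -> F) (p : {mpoly F[2]}) (d : nat) (Z : 'M[F]_(m * n)) :
  p = \sum_(i < K.+1) \sum_(j < K.+1) a i j *: ('X_ix ^+ i * 'X_iy ^+ j) ->
  local_degree p lambda mu d ->
  \sum_(i < K.+1) \sum_(j < K.+1)
     a i j *: (jordan_block m lambda ^+ i *t jordan_block n mu ^+ j)
    = (eval2 p lambda mu)%:M + Z ->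
  raises_weight (@tens_weight m n) d Z.
Proof.
move=> p_def [_ _ d_min] P_def u v.
have ZE := canRL (addKr _) (esym P_def).
case: (mxtens_indexP u) => u1 u2; case: (mxtens_indexP v) => v1 v2.
rewrite /tens_weight !mxtens_indexK /= ZE mxE poly_tens_jordanE // -p_def !mxE.
rewrite (can_eq (@mxtens_indexK _ _)).
case: ((u1, u2) =P (v1, v2)) => [[-> ->]|ne_uv].
  by rewrite !leqnn !subnn hasse00 addNr eqxx.
rewrite mulr0n oppr0 add0r; case: ifP => [/andP[le1 le2] nz|]; last by rewrite eqxx.
have gap : (u1 + u2 + (v1 - u1 + (v2 - u2)) = v1 + v2)%N.
  by rewrite addnACA !subnKC.
rewrite -gap leq_add2l; apply: d_min; last by exists (v1 - u1)%N, (v2 - u2)%N.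
rewrite lt0n addn_eq0 !subn_eq0; apply/negP => /andP[ge1 ge2].
by apply: ne_uv; congr (_, _); apply/val_inj/eqP; rewrite eqn_leq ?le1 ?le2.
Qed.

(** * The bound *)

Theorem proposition3p8 (F : closedFieldType) (charF0 : [pchar F] =i pred0)
    (m n : nat) (m_gt1 : (1 < m)%N) (n_gt1 : (1 < n)%N) (lambda mu : F)
    (K : nat) (a : nat -> nat -> F) (p : {mpoly F[2]})
    (p_def : p = \sum_(i < K.+1) \sum_(j < K.+1)
                   a i j *: ('X_ix ^+ i * 'X_iy ^+ j))
    (p_nonconst : forall c : F, p <> c%:MP)
    (d : nat) (d_def : local_degree p lambda mu d)
    (P : 'M[F]_(m * n))
    (P_def : P = \sum_(i < K.+1) \sum_(j < K.+1)
                   a i j *: (jordan_block m lambda ^+ i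
                             *t jordan_block n mu ^+ j))
    (Z : 'M[F]_(m * n)) (Z_def : P = (eval2 p lambda mu)%:M + Z) :
  nilpotent_mx Z /\
  forall (r : nat) (size : 'I_r -> nat) (ev : 'I_r -> F),
    is_jordan_form P size ev ->
    forall l : 'I_r,
      (size l)%:Z <= Num.ceil ((m + n - 1)%:R / d%:R : rat).
Proof.
have d_gt0 : (0 < d)%N by case: d_def.
have Zw : raises_weight (@tens_weight m n) d Z.
  by apply: (nilpotent_part_raises_weight charF0 p_def d_def); rewrite -P_def.
have Zk0 (k : nat) : (m + n - 1 <= k * d)%N -> Z ^+ k = 0.
  move=> le_k; apply: (raises_weight_eq0 (raises_weight_expr (k := k) Zw)) => u.
  exact: leq_trans (tens_weight_lt u) le_k.
split; first by exists (m + n - 1)%N; apply: Zk0; rewrite leq_pmulr.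
move=> r size ev jf l; set q : rat := _ / _.
have q_ge0 : 0 <= q by rewrite divr_ge0 ?ler0n.
have := ceil_ge q; have : 0 <= Num.ceil q.
  by rewrite ceil_ge0 (Order.POrderTheory.lt_le_trans _ q_ge0).
(* The ceiling is the natural number [k] used as exponent of [Z]. *)
case: (Num.ceil q) => // k _ le_qk; rewrite lez_nat.
apply: (jordan_form_size_le (c := eval2 p lambda mu) jf).
rewrite Z_def addrAC subrr add0r; apply: Zk0.
by move: le_qk; rewrite /q ler_pdivrMr ?ltr0n // -natrM ler_nat.
Qed.
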